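(* Let $x\in(0,\pi/2)$. (i) If $q\ge1$, then $N(\cos x;q)<\frac{\sin x}{x}<M(\cos x;q)$. (ii) If $0<q\le\frac{34}{35}$, then $M(\cos x;q)<\frac{\sin x}{x}<N(\cos x;q)$. (iii) If $q\le0$, then $\frac{\sin x}{x}>M(\cos x;q)$.
   Context: For $t\in(0,1)$ and $q\in\mathbb{R}$: $M(t;q)=\left(\frac{8}{15q}+\left(1-\frac{8}{15q}\right)t^q\right)^{5/(15q-8)}$ if $q\ne0,\frac8{15}$; $M(t;0)=\left(1-\frac8{15}\ln t\right)^{-5/8}$; $M(t;\frac8{15})=\exp\frac{5(t^{8/15}-1)}{8}$. For $q>0$: $N(t;q)=\left(\left(\frac2\pi\right)^{3q-8/5}+\left(1-\left(\frac2\pi\right)^{3q-8/5}\right)t^q\right)^{1/(3q-8/5)}$ if $q\ne\frac8{15}$, and $N(t;\frac8{15})=\left(\frac2\pi\right)^{1-t^{8/15}}$. *)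

(* Defs.v *)
From Stdlib Require Import Reals.
Open Scope R_scope.

(* M(t;q) for t in (0,1), q real. Powers with real exponents via Rpower
   (bases are positive in all cases used). *)
Definition Mmean (t q : R) : R :=
  if Req_EM_T q 0 then Rpower (1 - 8/15 * ln t) (-(5/8))
  else if Req_EM_T q (8/15) then exp (5 * (Rpower t (8/15) - 1) / 8)
  else Rpower (8/(15*q) + (1 - 8/(15*q)) * Rpower t q) (5/(15*q - 8)).

Definition Nmean (t q : R) : R :=
  if Req_EM_T q (8/15) then Rpower (2/PI) (1 - Rpower t (8/15))
  else Rpower (Rpower (2/PI) (3*q - 8/5)
                 + (1 - Rpower (2/PI) (3*q - 8/5)) * Rpower t q)
              (1/(3*q - 8/5)).

(* Main.v *)
Require Import Defs.
From Stdlib Require Import Reals Lra Lia.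
From Coquelicot Require Import Coquelicot.
Open Scope R_scope.

(* Put p = 3q - 8/5 and let B_a be [boxcox a], an increasing function.  The means M and N are
   exactly the solutions of B_p(M) = B_q(t)/3 and B_p(N) = L B_q(t), where 1/3 and L are the
   limits at 0 and at pi/2 of B_p(sin x / x) / B_q(cos x).  So everything follows once that
   quotient is strictly monotone, and by the monotone form of l'Hopital's rule it suffices
   that the quotient of the derivatives is.  Its logarithmic derivative is
   q A(x) + B(x) with A > 0, so only A + B > 0 and (34/35) A + B < 0 have to be checked;
   after clearing denominators these are trigonometric polynomial inequalities in 2x and 3x,
   which follow from Taylor bounds. *)

(** * Taylor bounds for sine and cosine on the half-line *)

Lemma nonneg_of_derive_nonneg (f df : R -> R) :
  f 0 = 0 -> (forall y, 0 <= y -> is_derive f y (df y)) ->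
  (forall y, 0 <= y -> 0 <= df y) -> forall y, 0 <= y -> 0 <= f y.
Proof.
intros f0 hf hdf y hy.
destruct (MVT_gen f 0 y df) as [c [hc e]].
- intros z hz. apply hf. rewrite Rmin_left in hz; lra.
- intros z hz. apply derivable_continuous_pt. exists (df z).
  apply is_derive_Reals, hf. rewrite Rmin_left in hz; lra.
- rewrite Rmin_left, Rmax_right in hc by lra.
  rewrite f0 in e. specialize (hdf c). nra.
Qed.

(** Reciprocal factorial, built by successive division: one step is exactly the factor produced by
    differentiating a monomial, and at a concrete order it unfolds to numerals that [field] can
    handle. *)
Fixpoint inv_fact (n : nat) : R :=
  match n with O => 1 | S m => inv_fact m / INR (S m) end.

(** The sums include the term of index [n], so [cosT n] has degree 2n and [sinT n] degree 2n+1;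
    differentiation sends [sinT n] to [cosT n] and [cosT (S n)] to [- sinT n]. *)
Definition cosT (n : nat) (y : R) : R :=
  sum_f_R0 (fun k => (-1) ^ k * (inv_fact (2 * k) * y ^ (2 * k))) n.
Definition sinT (n : nat) (y : R) : R :=
  sum_f_R0 (fun k => (-1) ^ k * (inv_fact (S (2 * k)) * y ^ S (2 * k))) n.

Lemma is_derive_monomial (k : nat) (y : R) :
  is_derive (fun y => inv_fact (S k) * y ^ S k) y (inv_fact k * y ^ k).
Proof.
auto_derive; [trivial|].
change (inv_fact (S k)) with (inv_fact k / INR (S k)).
change (match k with O => 1 | S _ => INR k + 1 end) with (INR (S k)).
rewrite S_INR.
pose proof (pos_INR k). field. lra.
Qed.

Lemma is_derive_sinT (n : nat) (y : R) : is_derive (sinT n) y (cosT n y).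
Proof.
unfold sinT, cosT. induction n as [|n IH].
- cbn [sum_f_R0]. apply (is_derive_scal (fun y => inv_fact (S (2*0)) * y ^ S (2*0))), is_derive_monomial.
- cbn [sum_f_R0]. refine (is_derive_plus _ _ _ _ _ IH _).
  apply (is_derive_scal (fun y => inv_fact (S (2*S n)) * y ^ S (2*S n))), is_derive_monomial.
Qed.

Lemma is_derive_cosT (n : nat) (y : R) : is_derive (cosT (S n)) y (- sinT n y).
Proof.
unfold sinT, cosT. induction n as [|n IH].
- cbn. auto_derive; [trivial|field].
- rewrite (tech5 (fun k => (-1) ^ k * (inv_fact (S (2 * k)) * y ^ S (2 * k)))).
  apply (is_derive_ext (fun y => cosT (S n) y + (-1) ^ S (S n) * (inv_fact (2 * S (S n)) * y ^ (2 * S (S n))))).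
  reflexivity.
  rewrite Ropp_plus_distr. refine (is_derive_plus _ _ _ _ _ IH _).
  replace (2 * S (S n))%nat with (S (S (2 * S n))) by lia.
  replace (- _) with ((-1) ^ S (S n) * (inv_fact (S (2 * S n)) * y ^ S (2 * S n))) by (simpl; ring).
  apply (is_derive_scal (fun y => inv_fact (S (S (2*S n))) * y ^ S (S (2*S n)))), is_derive_monomial.
Qed.

Lemma sinT_0 (n : nat) : sinT n 0 = 0.
Proof. unfold sinT. induction n as [|n IH]; cbn [sum_f_R0]; [simpl; ring|]. rewrite IH; simpl; ring. Qed.

Lemma cosT_0 (n : nat) : cosT n 0 = 1.
Proof.
unfold cosT. induction n as [|n IH]; cbn [sum_f_R0]; [simpl; ring|]. rewrite IH.
replace (2 * S n)%nat with (S (S (2 * n))) by lia. simpl; ring.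
Qed.

(** Start from cos y <= 1 and integrate repeatedly from 0. The cosine error of order n integrates to
    the sine error with the same sign, and that one to the cosine error of order n+1 with the
    opposite sign. No upper bound on y is involved. *)
Lemma taylor_sin_cos (n : nat) (y : R) : 0 <= y ->
  0 <= (-1) ^ n * (cosT n y - cos y) /\ 0 <= (-1) ^ n * (sinT n y - sin y).
Proof.
revert y.
assert (step : forall n, (forall y, 0 <= y -> 0 <= (-1) ^ n * (cosT n y - cos y)) ->
   forall y, 0 <= y -> 0 <= (-1) ^ n * (sinT n y - sin y)).
{ intros m hm.
  apply (nonneg_of_derive_nonneg _ (fun y => (-1) ^ m * (cosT m y - cos y))); [| |exact hm].
  - rewrite sinT_0, sin_0; ring.
  - intros y _. apply (is_derive_scal (fun y => sinT m y - sin y)).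
    refine (is_derive_minus _ _ _ _ _ (is_derive_sinT _ _) _). auto_derive; [trivial|ring]. }
induction n as [|n IH].
- assert (c0 : forall y, 0 <= y -> 0 <= (-1) ^ 0 * (cosT 0 y - cos y)).
  { intros y _. unfold cosT; cbn. generalize (COS_bound y); lra. }
  intros y hy; split; [apply c0 | apply step]; assumption.
- assert (c : forall y, 0 <= y -> 0 <= (-1) ^ S n * (cosT (S n) y - cos y)).
  { apply (nonneg_of_derive_nonneg _ (fun y => (-1) ^ n * (sinT n y - sin y))).
    - rewrite cosT_0, cos_0; ring.
    - intros y _.
      replace ((-1) ^ n * (sinT n y - sin y)) with ((-1) ^ S n * (- sinT n y - - sin y)) by (simpl; ring).
      apply (is_derive_scal (fun y => cosT (S n) y - cos y)).
      refine (is_derive_minus _ _ _ _ _ (is_derive_cosT _ _) _). auto_derive; [trivial|ring].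
    - intros y hy. apply (IH y hy). }
  intros y hy; split; [apply c | apply step]; assumption.
Qed.

Lemma sinT_ge (n : nat) (y : R) : 0 <= y -> sin y <= sinT (2 * n) y.
Proof. intros hy. generalize (proj2 (taylor_sin_cos (2 * n) y hy)). rewrite pow_1_even; lra. Qed.
Lemma cosT_ge (n : nat) (y : R) : 0 <= y -> cos y <= cosT (2 * n) y.
Proof. intros hy. generalize (proj1 (taylor_sin_cos (2 * n) y hy)). rewrite pow_1_even; lra. Qed.
Lemma sinT_le (n : nat) (y : R) : 0 <= y -> sinT (S (2 * n)) y <= sin y.
Proof. intros hy. generalize (proj2 (taylor_sin_cos (S (2 * n)) y hy)). rewrite pow_1_odd; lra. Qed.
Lemma cosT_le (n : nat) (y : R) : 0 <= y -> cosT (S (2 * n)) y <= cos y.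
Proof. intros hy. generalize (proj1 (taylor_sin_cos (S (2 * n)) y hy)). rewrite pow_1_odd; lra. Qed.

(** * Three trigonometric polynomial inequalities *)

(** At y = 2x this is twice the numerator of A(x), the coefficient of q in [log_ratio']. The range y
    < 4 comes from x < pi/2 < 2. *)
Lemma two_plus_cos_sin_pos (y : R) (h0 : 0 < y) (h1 : y < 4) :
  0 < y * (2 + cos y) - 3 * sin y.
Proof.
assert (hy : 0 <= y) by lra.
pose proof (cosT_le 2 y hy) as hc. pose proof (sinT_ge 3 y hy) as hs.
(* Cosine is replaced by a lower and sine by an upper Taylor polynomial; all terms below y^5
   cancel. *)
assert (e : y * (2 + cosT 5 y) - 3 * sinT 6 y = y ^ 5 * 
  (2/120 - 4 / 5040 * y^2 + 6/362880 * y ^ 4 - 8/39916800 * y^6 - 3/6227020800 * y^8)).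
{ unfold cosT, sinT; simpl; field. }
simpl in hc, hs.
assert (0 < 2/120 - 4 / 5040 * y^2 + 6/362880 * y ^ 4 - 8/39916800 * y^6 - 3/6227020800 * y^8).
{ assert (u : 0 < y^2 < 16) by nra. revert u.
  replace (y^4) with ((y^2)^2) by ring. replace (y^6) with ((y^2)^3) by ring. replace (y^8) with ((y^2)^4) by ring.
  generalize (y^2). intros u hu. 
  assert (u^2 < 256) by nra. assert (u ^3 < 4096) by nra. assert (u^4 < 65536) by nra. nra. }
assert (0 < y^5) by (apply pow_lt; lra).
nra.
Qed.

(** At y = 2x this is four times the numerator of [log_ratio' 1 x]. *)
Lemma double_angle_poly_pos (y : R) (h0 : 0 < y) (h1 : y < 4) :
  0 < y ^ 2 * (4 - cos y) + 9 * y * sin y - 24 + 24 * cos y.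
Proof.
assert (hy : 0 <= y) by lra.
pose proof (cosT_le 2 y hy) as hc. pose proof (sinT_le 2 y hy) as hs.
simpl in hc, hs.
assert (u : 0 < y ^ 2 < 16) by nra.
(* The total coefficient of cos y is 24 - y^2, positive for y < 4, so lower Taylor bounds serve for
   both functions; the terms below y^8 cancel. *)
assert (e : (24 - y ^ 2) * cosT 5 y + 9 * y * sinT 5 y + 4 * y ^ 2 - 24 =
  (y ^ 2) ^ 4 * (1/5040 - 1/151200 * y ^ 2 + 1/19958400 * (y ^ 2) ^ 2)).
{ unfold cosT, sinT; simpl; field. }
assert (0 < (y ^ 2) ^ 4) by (apply pow_lt; lra).
assert (0 < 1/5040 - 1/151200 * y ^ 2 + 1/19958400 * (y ^ 2) ^ 2) by nra.
nra.
Qed.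

(** This is four times the numerator of [log_ratio' (34/35) x], linearised in the angles x and 3x.
    Near 0, [log_ratio' q x] behaves like (4/15)(q - 34/35) x^3, so 34/35 is the value of q at which
    this leading term disappears. *)
Lemma triple_angle_poly_neg (x : R) (h0 : 0 < x) (h1 : x < 2) :
  x ^ 2 * (108 * cos x - 12 * cos (3 * x)) + x * (54 * sin x + 58 * sin (3 * x))
    - 81 * cos x + 81 * cos (3 * x) < 0.
Proof.
assert (hx : 0 <= x) by lra. assert (hx3 : 0 <= 3 * x) by lra.
pose proof (cosT_ge 4 x hx) as c1u. pose proof (cosT_le 3 x hx) as c1l.
pose proof (cosT_ge 4 (3 * x) hx3) as c3u. pose proof (cosT_le 3 (3 * x) hx3) as c3l.
pose proof (sinT_ge 4 x hx) as s1u. pose proof (sinT_ge 4 (3 * x) hx3) as s3u.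
simpl in c1u, c1l, c3u, c3l, s1u, s3u.
assert (u : 0 < x ^ 2 < 4) by nra.
(* Each term gets an upper or a lower Taylor polynomial according to the sign of its coefficient.
   Everything below x^10 cancels. *)
assert (e : x ^ 2 * (108 * cosT 8 x - 12 * cosT 7 (3 * x))
    + x * (54 * sinT 8 x + 58 * sinT 8 (3 * x)) - 81 * cosT 7 x + 81 * cosT 8 (3 * x) =
  (x ^ 2) ^ 5 * (- 64/525 + 32/1155 * x ^ 2 - 1528/525525 * (x ^ 2) ^ 2
    + 146145283/774918144000 * (x ^ 2) ^ 3 + 17338267/823350528000 * (x ^ 2) ^ 4)).
{ unfold cosT, sinT; simpl; field. }
assert (0 < (x ^ 2) ^ 5) by (apply pow_lt; lra).
assert (- 64/525 + 32/1155 * x ^ 2 - 1528/525525 * (x ^ 2) ^ 2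
    + 146145283/774918144000 * (x ^ 2) ^ 3 + 17338267/823350528000 * (x ^ 2) ^ 4 < 0).
{ revert u. generalize (x ^ 2). intros v hv.
  (* The cubic and quartic terms have positive coefficients. Absorbed into the square term they
     leave its coefficient negative, and the affine part is already negative for v < 4. *)
  assert (v ^ 3 <= 4 * v ^ 2) by nra. assert (v ^ 4 <= 16 * v ^ 2) by nra.
  nra. }
assert (x ^ 2 * (108 * cos x - 12 * cos (3 * x)) <= x ^ 2 * (108 * cosT 8 x - 12 * cosT 7 (3 * x)))
  by (apply Rmult_le_compat_l; lra).
assert (x * (54 * sin x + 58 * sin (3 * x)) <= x * (54 * sinT 8 x + 58 * sinT 8 (3 * x)))
  by (apply Rmult_le_compat_l; lra).
nra.
Qed.

(** * Monotonicity and one-sided limits *)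

Lemma incr_of_derive_pos (f df : R -> R) (u v : R) :
  u < v -> (forall c, u <= c <= v -> is_derive f c (df c)) ->
  (forall c, u < c < v -> 0 < df c) -> f u < f v.
Proof.
intros huv hf hdf.
destruct (MVT_cor2 f df u v huv) as [c [e hc]].
- intros c hc. apply is_derive_Reals, hf, hc.
- specialize (hdf c hc). nra.
Qed.

Lemma at_right_between (a b : R) : a < b -> at_right a (fun u => a < u < b).
Proof.
intros hab. assert (h : 0 < b - a) by lra. exists (mkposreal _ h). intros u hu hau.
apply Rabs_def2 in hu. simpl in hu. unfold minus, plus, opp in hu; simpl in hu. lra.
Qed.

Lemma at_left_between (a b : R) : a < b -> at_left b (fun u => a < u < b).
Proof.
intros hab. assert (h : 0 < b - a) by lra. exists (mkposreal _ h). intros u hu hau.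
apply Rabs_def2 in hu. simpl in hu. unfold minus, plus, opp in hu; simpl in hu. lra.
Qed.

(** Passing to the limit keeps only weak inequalities; strictness is gained by comparing through the
    midpoint [m]. *)
Lemma lim_lt_of_incr (f : R -> R) (a x l : R) : a < x ->
  (forall u v, a < u -> u < v -> v <= x -> f u < f v) ->
  filterlim f (at_right a) (locally l) -> l < f x.
Proof.
intros hax hf hl. set (m := (a + x) / 2).
assert (hm : a < m < x) by (unfold m; lra).
apply Rle_lt_trans with (f m); [|apply hf; lra].
apply (filterlim_le (F := at_right a) f (fun _ => f m) l (f m)).
- apply (filter_imp (fun u => a < u < m)); [|apply at_right_between; lra].
  intros u hu. left; apply hf; lra.
- exact hl.
- apply filterlim_const.
Qed.

Lemma lt_lim_of_incr (f : R -> R) (b x l : R) : x < b ->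
  (forall u v, x <= u -> u < v -> v < b -> f u < f v) ->
  filterlim f (at_left b) (locally l) -> f x < l.
Proof.
intros hax hf hl. set (m := (x + b) / 2).
assert (hm : x < m < b) by (unfold m; lra).
apply Rlt_le_trans with (f m); [apply hf; lra|].
apply (filterlim_le (F := at_left b) (fun _ => f m) f (f m) l).
- apply (filter_imp (fun u => m < u < b)); [|apply at_left_between; lra].
  intros u hu. left; apply hf; lra.
- apply filterlim_const.
- exact hl.
Qed.

Lemma filterlim_sub_scal (T : Type) (Fi : (T -> Prop) -> Prop) (hF : Filter Fi)
  (f g : T -> R) (k a b : R) :
  filterlim f Fi (locally a) -> filterlim g Fi (locally b) ->
  filterlim (fun x => f x - k * g x) Fi (locally (a - k * b)).
Proof.
intros hf hg.
apply (filterlim_comp_2 (G := locally a) (H := locally (- (k * b)))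
  f (fun x => - (k * g x)) Rplus hf).
- apply (filterlim_comp _ _ _ g (fun y => - (k * y)) Fi (locally b)); [exact hg|].
  apply (continuous_opp (V := R_NormedModule) (fun y : R => k * y) b).
  apply (continuous_mult (K := R_AbsRing) (fun _ => k) (fun y => y) b); [apply continuous_const|apply continuous_id].
- apply (filterlim_plus (K := R_AbsRing) (V := R_NormedModule) a (- (k * b))).
Qed.

(** * Monotone form of l'Hopital's rule *)

Section MonotoneRatio.
Variables (F G dG r : R -> R) (a b : R).
Hypothesis derF : forall x, a < x < b -> is_derive F x (r x * dG x).
Hypothesis derG : forall x, a < x < b -> is_derive G x (dG x).
Hypothesis dG_pos : forall x, a < x < b -> 0 < dG x.
Hypothesis r_incr : forall x y, a < x -> x < y -> y < b -> r x < r y.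
Hypothesis F_a : filterlim F (at_right a) (locally 0).
Hypothesis G_a : filterlim G (at_right a) (locally 0).

Let derD (k x : R) : a < x < b ->
  is_derive (fun x => F x - k * G x) x ((r x - k) * dG x).
Proof.
intros hx. replace ((r x - k) * dG x) with (r x * dG x - k * dG x) by ring.
refine (is_derive_minus _ _ _ _ _ (derF x hx) _). apply (is_derive_scal G x k), derG, hx.
Qed.

Let D_a (k : R) : filterlim (fun x => F x - k * G x) (at_right a) (locally 0).
Proof.
replace 0 with (0 - k * 0) by ring. apply filterlim_sub_scal; [apply within_filter, locally_filter|assumption..].
Qed.

(** Here [r] is F'/G', entered as a factor so that no quotient occurs. Being increasing, [r] stays
    above its initial limit [r0], so F - r0 G increases from the limit 0. *)
Lemma ratio_gt_initial_limit (r0 x : R) :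
  filterlim r (at_right a) (locally r0) -> a < x < b -> r0 * G x < F x.
Proof.
intros hr hx. apply Rlt_0_minus.
apply (lim_lt_of_incr (fun x => F x - r0 * G x) a x 0); [lra| |apply D_a].
intros u v hau huv hvx.
apply (incr_of_derive_pos (fun x => F x - r0 * G x) (fun x => (r x - r0) * dG x)); [assumption| |].
- intros c hc. apply derD. lra.
- intros c hc. apply Rmult_lt_0_compat; [|apply dG_pos; lra].
  apply Rlt_0_minus, (lim_lt_of_incr r a c r0); [lra| |exact hr].
  intros; apply r_incr; lra.
Qed.

Lemma ratio_lt_final_limit (k x : R) :
  filterlim (fun x => F x - k * G x) (at_left b) (locally 0) -> a < x < b -> F x < k * G x.
Proof.
(* F - k G vanishes at both ends, decreases as long as r < k and increases once r > k. *)
intros hb hx. destruct (Rle_or_lt (r x) k) as [h|h].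
- apply Ropp_lt_cancel, Rlt_0_minus.
  replace (- F x - - (k * G x)) with (- (F x - k * G x)) by ring.
  apply (lim_lt_of_incr (fun x => - (F x - k * G x)) a x 0); [lra| |].
  + intros u v hau huv hvx.
    apply (incr_of_derive_pos (fun x => - (F x - k * G x)) (fun x => - ((r x - k) * dG x))); [assumption| |].
    * intros c hc. apply (is_derive_opp (fun x => F x - k * G x)), derD. lra.
    * intros c hc. assert (r c < r x) by (apply r_incr; lra).
      assert (0 < dG c) by (apply dG_pos; lra). nra.
  + replace 0 with (- 0) by ring.
    apply (filterlim_comp _ _ _ _ Ropp _ _ _ (D_a k)), (filterlim_opp (K := R_AbsRing) (V := R_NormedModule)).
- apply Rlt_0_minus, Ropp_lt_cancel. rewrite Ropp_0.
  replace (- (k * G x - F x)) with (F x - k * G x) by ring.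
  apply (lt_lim_of_incr (fun x => F x - k * G x) b x 0); [lra| |exact hb].
  intros u v hxu huv hvb.
  apply (incr_of_derive_pos (fun x => F x - k * G x) (fun x => (r x - k) * dG x)); [assumption| |].
  + intros c hc. apply derD. lra.
  + intros c hc. assert (r x < r c) by (apply r_incr; lra).
    assert (0 < dG c) by (apply dG_pos; lra). nra.
Qed.
End MonotoneRatio.

(** * The Box-Cox transform and the two means *)

(** The antiderivative of u^(a-1) that vanishes at 1. The logarithmic case a = 0 absorbs the
    exceptional values q = 0 (through B_q) and q = 8/15 (through B_p, since p = 3q - 8/5 vanishes
    there). *)
Definition boxcox (a u : R) : R :=
  if Req_EM_T a 0 then ln u else (Rpower u a - 1) / a.

Lemma is_derive_boxcox (a u : R) : 0 < u -> is_derive (boxcox a) u (Rpower u (a - 1)).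
Proof.
intros hu. unfold boxcox, Rpower. destruct (Req_EM_T a 0) as [->|ha].
- replace (exp ((0 - 1) * ln u)) with (/ u); [apply is_derive_ln, hu|].
  replace ((0 - 1) * ln u) with (- ln u) by ring. rewrite exp_Ropp, exp_ln; trivial.
- auto_derive; [exact hu|].
  replace ((a - 1) * ln u) with (a * ln u + - ln u) by ring.
  rewrite exp_plus, exp_Ropp, exp_ln by exact hu. field; lra.
Qed.

Lemma boxcox_1 (a : R) : boxcox a 1 = 0.
Proof.
unfold boxcox, Rpower. rewrite ln_1. destruct (Req_EM_T a 0); [reflexivity|].
rewrite Rmult_0_r, exp_0. field; assumption.
Qed.

Lemma boxcox_lt (a u v : R) : 0 < u -> u < v -> boxcox a u < boxcox a v.
Proof.
intros hu huv. apply (incr_of_derive_pos (boxcox a) (fun u => Rpower u (a - 1))); [assumption| |].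
- intros c hc. apply is_derive_boxcox. lra.
- intros c _. apply exp_pos.
Qed.

Lemma boxcox_lt_inv (a u v : R) : 0 < u -> 0 < v -> boxcox a u < boxcox a v -> u < v.
Proof.
intros hu hv h. destruct (Rtotal_order u v) as [|[e|e]]; [assumption| |].
- subst v. lra.
- generalize (boxcox_lt a v u hv e). lra.
Qed.

Lemma Mmean_pos (t q : R) : 0 < Mmean t q.
Proof. unfold Mmean. destruct (Req_EM_T q 0), (Req_EM_T q (8/15)); apply exp_pos. Qed.

Lemma Nmean_pos (t q : R) : 0 < Nmean t q.
Proof. unfold Nmean. destruct (Req_EM_T q (8/15)); apply exp_pos. Qed.

Lemma boxcox_Rpower (a b : R) : a <> 0 -> 0 < b -> boxcox a (Rpower b (1 / a)) = (b - 1) / a.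
Proof.
intros ha hb. unfold boxcox. destruct (Req_EM_T a 0) as [|_]; [contradiction|].
rewrite Rpower_mult. replace (1 / a * a) with 1 by (field; assumption).
rewrite Rpower_1 by assumption. reflexivity.
Qed.

Lemma boxcox_Mmean (t q : R) : 0 < t < 1 ->
  boxcox (3 * q - 8/5) (Mmean t q) = 1/3 * boxcox q t.
Proof.
intros ht.
assert (hneg : boxcox q t < 0) by (rewrite <- (boxcox_1 q); apply boxcox_lt; lra).
unfold Mmean. destruct (Req_EM_T q 0) as [e|h0].
- replace (- (5/8)) with (1 / (3 * q - 8/5)) by (rewrite e; field).
  unfold boxcox in hneg |- * at 2. destruct (Req_EM_T q 0) as [_|]; [|contradiction].
  rewrite boxcox_Rpower by lra. rewrite e. field.
- destruct (Req_EM_T q (8/15)) as [e|h1].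
  + subst q. unfold boxcox.
    destruct (Req_EM_T (3 * (8/15) - 8/5) 0) as [_|]; [|lra].
    destruct (Req_EM_T (8/15) 0); [lra|]. rewrite ln_exp. field.
  + replace (5 / (15 * q - 8)) with (1 / (3 * q - 8/5)) by (field; lra).
    unfold boxcox in hneg |- * at 2. destruct (Req_EM_T q 0) as [|_]; [contradiction|].
    rewrite boxcox_Rpower; [field; lra|lra|].
    assert (0 < Rpower t q) by apply exp_pos.
    (* The base of M is t^q - (8/15) B_q(t), positive because B_q(t) < 0 for t < 1. *)
    replace (8 / (15 * q) + (1 - 8 / (15 * q)) * Rpower t q)
      with (Rpower t q - 8/15 * ((Rpower t q - 1) / q)) by (field; assumption).
    lra.
Qed.

(** B_p(N) equals B_p(2/pi)(1 - t^q), and 1 - t^q = -q B_q(t). The factor -q B_p(2/pi) is the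
    constant L. *)
Lemma boxcox_Nmean (t q : R) : 0 < t < 1 -> 0 < q ->
  boxcox (3 * q - 8/5) (Nmean t q) = - (q * boxcox (3 * q - 8/5) (2 / PI)) * boxcox q t.
Proof.
intros ht hq.
assert (hneg : boxcox q t < 0) by (rewrite <- (boxcox_1 q); apply boxcox_lt; lra).
unfold boxcox in hneg |- * at 3. destruct (Req_EM_T q 0) as [|_]; [lra|].
unfold Nmean. destruct (Req_EM_T q (8/15)) as [e|h1].
- unfold boxcox. destruct (Req_EM_T (3 * q - 8/5) 0) as [_|]; [|lra].
  rewrite <- e. unfold Rpower at 1. rewrite ln_exp. field. lra.
- assert (hp : 3 * q - 8/5 <> 0) by lra.
  set (p := 3 * q - 8/5) in *.
  assert (0 < Rpower t q) by apply exp_pos.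
  assert (Rpower t q < 1).
  { apply Rminus_lt. apply (Rmult_lt_reg_r (/ q)); [apply Rinv_0_lt_compat, hq|]. lra. }
  assert (0 < Rpower (2 / PI) p) by apply exp_pos.
  (* The base is a convex combination of (2/pi)^p and 1 with weight t^q on 1, hence positive
     whatever the sign of p. *)
  rewrite boxcox_Rpower; [|assumption|nra].
  unfold boxcox. destruct (Req_EM_T p 0) as [|_]; [contradiction|]. field. lra.
Qed.

(** * The logarithm of the derivative quotient and the sign of its derivative *)

(* The logarithm of defect_sinc' / defect_cos', with the factors grouped so that each of them
   has a finite limit at 0. *)
Definition log_ratio (q x : R) : R :=
  (3 * q - 18/5) * ln (sin x / x) + ln ((sin x - x * cos x) / x ^ 3) + (1 - q) * ln (cos x).

Definition log_ratio' (q x : R) : R :=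
  (3 * q - 13/5) * (cos x / sin x - 1 / x) + x * sin x / (sin x - x * cos x)
    - 2 / x - cos x / sin x + (q - 1) * (sin x / cos x).

(** Low-order Taylor bounds, sharp enough to give both positivity and the limit 1/3 after division
    by x^3. *)
Lemma sin_sub_xcos_bounds (x : R) : 0 < x < 2 ->
  x ^ 3 * (1/3 - x ^ 2 / 24) <= sin x - x * cos x <= x ^ 3 * (1/3).
Proof.
intros hx. assert (h : 0 <= x) by lra.
pose proof (sinT_ge 1 x h) as su. pose proof (sinT_le 0 x h) as sl.
pose proof (cosT_ge 1 x h) as cu. pose proof (cosT_le 1 x h) as cl.
unfold sinT, cosT in su, sl, cu, cl. simpl in su, sl, cu, cl.
apply (Rmult_le_compat_l x) in cu; [|exact h]. apply (Rmult_le_compat_l x) in cl; [|exact h].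
assert (h3 : 0 < x ^ 3) by (apply pow_lt; lra).
assert (h2 : x ^ 2 < 24) by nra.
split; [lra|].
(* The Taylor upper bound is x^3/3 - x^5 (24 - x^2)/720. *)
assert (0 < x ^ 5 * (24 - x ^ 2)) by (apply Rmult_lt_0_compat; [apply pow_lt|]; lra).
lra.
Qed.

Lemma half_pi_lt_2 (x : R) : x < PI / 2 -> x < 2.
Proof. generalize PI_4. lra. Qed.

Lemma sin_sub_xcos_pos (x : R) : 0 < x < PI / 2 -> 0 < sin x - x * cos x.
Proof.
intros hx. assert (h : x < 2) by (apply half_pi_lt_2; lra).
apply Rlt_le_trans with (x ^ 3 * (1/3 - x ^ 2 / 24)); [|apply sin_sub_xcos_bounds; lra].
apply Rmult_lt_0_compat; [apply pow_lt; lra|nra].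
Qed.

Lemma sin_cos_pos (x : R) : 0 < x < PI / 2 -> 0 < sin x /\ 0 < cos x.
Proof. intros hx. generalize PI_RGT_0; intro. split; [apply sin_gt_0|apply cos_gt_0]; lra. Qed.

Lemma is_derive_log_ratio (q x : R) : 0 < x < PI / 2 ->
  is_derive (log_ratio q) x (log_ratio' q x).
Proof.
intros hx. destruct (sin_cos_pos x hx) as [s c]. pose proof (sin_sub_xcos_pos x hx) as d.
assert (x3 : 0 < x ^ 3) by (apply pow_lt; lra).
unfold log_ratio, log_ratio'. auto_derive.
- simpl in x3 |- *. repeat split; trivial; try lra.
  + apply Rdiv_lt_0_compat; lra.
  + apply Rdiv_lt_0_compat; lra.
- field. repeat split; lra.
Qed.

(** Since [log_ratio'] is affine in q with this slope, its sign need only be settled at q = 1 and at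
    q = 34/35. *)
Lemma coef_q_log_ratio'_pos (x : R) : 0 < x < PI / 2 -> 0 < 3 * (cos x / sin x - 1 / x) + sin x / cos x.
Proof.
intros hx. destruct (sin_cos_pos x hx) as [s c].
pose proof (half_pi_lt_2 x) as h.
pose proof (two_plus_cos_sin_pos (2 * x)) as e. rewrite cos_2a_cos, sin_2a in e.
replace (3 * (cos x / sin x - 1 / x) + sin x / cos x)
  with ((3 * x * cos x ^ 2 - 3 * sin x * cos x + x * sin x ^ 2) / (x * sin x * cos x))
  by (field; lra).
apply Rdiv_lt_0_compat; [|repeat apply Rmult_lt_0_compat; lra].
replace (sin x ^ 2) with (1 - cos x ^ 2) by (generalize (sin2_cos2 x); unfold Rsqr; lra).
lra.
Qed.

Lemma log_ratio'_pos (q x : R) : 1 <= q -> 0 < x < PI / 2 -> 0 < log_ratio' q x.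
Proof.
intros hq hx. destruct (sin_cos_pos x hx) as [s c]. pose proof (sin_sub_xcos_pos x hx) as d.
pose proof (half_pi_lt_2 x) as h. pose proof (coef_q_log_ratio'_pos x hx) as hA.
pose proof (double_angle_poly_pos (2 * x)) as e. rewrite cos_2a_cos, sin_2a in e.
replace (log_ratio' q x) with ((q - 1) * (3 * (cos x / sin x - 1 / x) + sin x / cos x)
  + (5 * x ^ 2 * sin x ^ 2 - 3 * x * cos x * (sin x - x * cos x)
     - 12 * sin x * (sin x - x * cos x)) / (5 * x * sin x * (sin x - x * cos x)))
  by (unfold log_ratio'; field; lra).
apply Rplus_le_lt_0_compat; [apply Rmult_le_pos; lra|].
apply Rdiv_lt_0_compat; [|repeat apply Rmult_lt_0_compat; lra].
assert (e2 : sin x ^ 2 = 1 - cos x ^ 2) by (generalize (sin2_cos2 x); unfold Rsqr; lra).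
replace (5 * x ^ 2 * sin x ^ 2 - 3 * x * cos x * (sin x - x * cos x)
     - 12 * sin x * (sin x - x * cos x)) with
  (5 * x ^ 2 * sin x ^ 2 + 3 * x ^ 2 * cos x ^ 2 + 9 * x * sin x * cos x - 12 * sin x ^ 2) by ring.
rewrite e2. lra.
Qed.

Lemma cos_3x (x : R) : cos (3 * x) = 4 * cos x ^ 3 - 3 * cos x.
Proof.
replace (3 * x) with (2 * x + x) by ring. rewrite cos_plus, cos_2a_cos, sin_2a.
generalize (sin2_cos2 x). unfold Rsqr. intros e.
replace (2 * sin x * cos x * sin x) with (2 * cos x * (sin x * sin x)) by ring.
replace (sin x * sin x) with (1 - cos x * cos x) by lra. ring.
Qed.

Lemma sin_3x (x : R) : sin (3 * x) = sin x * (4 * cos x ^ 2 - 1).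
Proof.
replace (3 * x) with (2 * x + x) by ring. rewrite sin_plus, cos_2a_cos, sin_2a. ring.
Qed.

Lemma log_ratio'_neg (q x : R) : q <= 34/35 -> 0 < x < PI / 2 -> log_ratio' q x < 0.
Proof.
intros hq hx. destruct (sin_cos_pos x hx) as [s c]. pose proof (sin_sub_xcos_pos x hx) as d.
pose proof (half_pi_lt_2 x) as h. pose proof (coef_q_log_ratio'_pos x hx) as hA.
pose proof (triple_angle_poly_neg x) as e. rewrite cos_3x, sin_3x in e.
replace (log_ratio' q x) with (- ((34/35 - q) * (3 * (cos x / sin x - 1 / x) + sin x / cos x)
  + (- (36 * x ^ 2 * sin x ^ 2 * cos x + 24 * x ^ 2 * cos x ^ 3 + 57 * x * sin x * cos x ^ 2
     - 81 * sin x ^ 2 * cos x - x * sin x * sin x ^ 2))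
    / (35 * x * sin x * cos x * (sin x - x * cos x))))
  by (unfold log_ratio'; field; lra).
apply Ropp_lt_gt_0_contravar.
apply Rplus_le_lt_0_compat; [apply Rmult_le_pos; lra|].
apply Rdiv_lt_0_compat; [|repeat apply Rmult_lt_0_compat; lra].
assert (e2 : sin x ^ 2 = 1 - cos x ^ 2) by (generalize (sin2_cos2 x); unfold Rsqr; lra).
rewrite e2. lra.
Qed.

(** * Limits at 0 and at pi/2 *)

Lemma filterlim_at_right_of_continuous (f : R -> R) (a : R) :
  continuous f a -> filterlim f (at_right a) (locally (f a)).
Proof. intros h. apply (filterlim_filter_le_1 (F := locally a)); [apply filter_le_within|exact h]. Qed.

Lemma filterlim_at_left_of_continuous (f : R -> R) (a : R) :
  continuous f a -> filterlim f (at_left a) (locally (f a)).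
Proof. intros h. apply (filterlim_filter_le_1 (F := locally a)); [apply filter_le_within|exact h]. Qed.

Lemma continuous_boxcox (a u : R) : 0 < u -> continuous (boxcox a) u.
Proof. intros hu. apply (ex_derive_continuous (boxcox a)). eexists. apply is_derive_boxcox, hu. Qed.

Lemma lim_sinc_0 : filterlim (fun x => sin x / x) (at_right 0) (locally 1).
Proof.
apply (filterlim_filter_le_1 (F := Rbar_locally' 0)); [|exact is_lim_sinc_0].
intros P [d hd]. exists d. intros y hy h. apply hd; [exact hy|]. lra.
Qed.

Lemma lim_cos_0 : filterlim cos (at_right 0) (locally 1).
Proof. rewrite <- cos_0. apply filterlim_at_right_of_continuous, continuous_cos. Qed.

Lemma lim_sin_sub_xcos_0 :
  filterlim (fun x => (sin x - x * cos x) / x ^ 3) (at_right 0) (locally (1/3)).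
Proof.
apply (filterlim_le_le (F := at_right 0) (fun x => 1/3 - x ^ 2 / 24) _ (fun _ => 1/3) (Finite (1/3))).
- apply (filter_imp (fun x => 0 < x < 2)); [|apply at_right_between; lra].
  intros x hx. pose proof (sin_sub_xcos_bounds x hx).
  assert (h3 : 0 < x ^ 3) by (apply pow_lt; lra).
  split; [apply (proj1 (Rle_div_r _ _ _ h3))|apply (proj2 (Rle_div_l _ _ _ h3))]; lra.
- replace (Finite (1/3)) with (Finite (1/3 - 0 ^ 2 / 24)) by (f_equal; field).
  apply (filterlim_at_right_of_continuous (fun x => 1/3 - x ^ 2 / 24)).
  apply (ex_derive_continuous (fun x => 1/3 - x ^ 2 / 24)). auto_derive; trivial.
- apply filterlim_const.
Qed.

(** sin x / x and cos x both tend to 1, so their logarithms vanish in the limit; only the middle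
    term survives, whatever q is. This yields the constant 1/3 for M. *)
Lemma lim_log_ratio_0 (q : R) : filterlim (log_ratio q) (at_right 0) (locally (ln (1/3))).
Proof.
unfold log_ratio.
assert (ln_lim : forall f l, 0 < l -> filterlim f (at_right 0) (locally l) ->
  filterlim (fun x : R => ln (f x)) (at_right 0) (locally (ln l))).
{ intros f l hl hf. apply (filterlim_comp _ _ _ f ln _ (locally l)); [exact hf|].
  apply continuous_ln, hl. }
assert (h3 : 0 < 1/3) by lra.
pose proof (ln_lim _ _ Rlt_0_1 lim_sinc_0) as h.
pose proof (ln_lim _ _ h3 lim_sin_sub_xcos_0) as k.
pose proof (ln_lim _ _ Rlt_0_1 lim_cos_0) as m.
rewrite ln_1 in h, m.
assert (FF : Filter (at_right 0)) by (apply within_filter, locally_filter).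
pose proof (filterlim_sub_scal _ _ FF _ _ (- (3 * q - 18/5)) _ _ k h) as hk.
pose proof (filterlim_sub_scal _ _ FF _ _ (q - 1) _ _ hk m) as hm.
replace (ln (1/3)) with (ln (1/3) - - (3 * q - 18/5) * 0 - (q - 1) * 0) by ring.
revert hm. apply filterlim_ext. intros x. ring.
Qed.

(** Continuity at 0 is of no help: [ln 0] is 0 by convention, which makes [Rpower 0 q] equal to 1.
    The limit goes through [ln] tending to minus infinity. *)
Lemma lim_Rpower_0 (q : R) : 0 < q -> filterlim (fun t => Rpower t q) (at_right 0) (locally 0).
Proof.
intros hq. unfold Rpower.
apply (filterlim_comp _ _ _ (fun t => q * ln t) exp _ (Rbar_locally m_infty)); [|exact is_lim_exp_m].
apply (filterlim_comp _ _ _ ln (Rmult q) _ (Rbar_locally m_infty)); [exact is_lim_ln_0|].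
intros P [m hm]. exists (m / q). intros y hy. apply hm.
apply (proj2 (Rlt_div_r _ _ _ hq)) in hy. lra.
Qed.

Lemma lim_cos_half_pi : filterlim cos (at_left (PI / 2)) (at_right 0).
Proof.
pose proof (filterlim_at_left_of_continuous cos (PI / 2) (continuous_cos _)) as h.
rewrite cos_PI2 in h. intros P hP. specialize (h _ hP).
assert (k : at_left (PI / 2) (fun x => 0 < cos x)).
{ apply (filter_imp (fun x => 0 < x < PI / 2)); [|apply at_left_between; generalize PI_RGT_0; lra].
  intros x hx. apply (sin_cos_pos x hx). }
generalize (filter_and _ _ h k). apply filter_imp. intros x [u v]; apply u, v.
Qed.

(** * The two defects, their derivatives and their limits *)

(** The sign makes both defects positive on (0, pi/2), where sin x / x and cos x are below 1. They
    play the roles of F and G in the monotone rule. *)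
Definition defect_sinc (q x : R) : R := - boxcox (3 * q - 8/5) (sin x / x).
Definition defect_cos (q x : R) : R := - boxcox q (cos x).

Lemma is_derive_defect_cos (q x : R) : 0 < x < PI / 2 ->
  is_derive (defect_cos q) x (Rpower (cos x) (q - 1) * sin x).
Proof.
intros hx. destruct (sin_cos_pos x hx) as [s c]. unfold defect_cos.
replace (_ * _) with (- (- sin x * Rpower (cos x) (q - 1))) by ring.
apply (is_derive_opp (fun x => boxcox q (cos x))).
apply (is_derive_comp (boxcox q) cos); [apply is_derive_boxcox, c|apply is_derive_cos].
Qed.

Lemma is_derive_defect_sinc (q x : R) : 0 < x < PI / 2 ->
  is_derive (defect_sinc q) x (exp (log_ratio q x) * (Rpower (cos x) (q - 1) * sin x)).
Proof.
intros hx. destruct (sin_cos_pos x hx) as [s c]. pose proof (sin_sub_xcos_pos x hx) as d.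
assert (hS : 0 < sin x / x) by (apply Rdiv_lt_0_compat; lra).
assert (hJ : 0 < (sin x - x * cos x) / x ^ 3) by (apply Rdiv_lt_0_compat; [|apply pow_lt]; lra).
unfold defect_sinc.
replace (exp (log_ratio q x) * (Rpower (cos x) (q - 1) * sin x))
  with (- ((x * cos x - sin x) / x ^ 2 * Rpower (sin x / x) (3 * q - 8/5 - 1))).
- apply (is_derive_opp (fun x => boxcox (3 * q - 8/5) (sin x / x))).
  apply (is_derive_comp (boxcox (3 * q - 8/5)) (fun x => sin x / x)).
  + apply is_derive_boxcox, hS.
  + auto_derive; [lra|field; lra].
- unfold log_ratio, Rpower.
  (* One factor sin x / x is split off: its sine is the one in the derivative of [defect_cos], and
     its 1/x turns x^2 into x^3. *)
  replace ((3 * q - 8/5 - 1) * ln (sin x / x))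
    with ((3 * q - 18/5) * ln (sin x / x) + ln (sin x / x)) by field.
  replace ((q - 1) * ln (cos x)) with (- ((1 - q) * ln (cos x))) by ring.
  rewrite !exp_plus, exp_Ropp, !exp_ln by assumption.
  generalize (exp_pos ((1 - q) * ln (cos x))). intro. field. lra.
Qed.

Lemma lim_defect_sinc_0 (q : R) : filterlim (defect_sinc q) (at_right 0) (locally 0).
Proof.
replace 0 with (- boxcox (3 * q - 8/5) 1) at 2 by (rewrite boxcox_1; ring).
apply (filterlim_comp _ _ _ (fun x => sin x / x) (fun u => - boxcox (3 * q - 8/5) u) _ _ _ lim_sinc_0).
apply (continuous_opp (V := R_NormedModule) (boxcox (3 * q - 8/5))), continuous_boxcox. lra.
Qed.

Lemma lim_defect_cos_0 (q : R) : filterlim (defect_cos q) (at_right 0) (locally 0).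
Proof.
replace 0 with (- boxcox q 1) at 2 by (rewrite boxcox_1; ring).
apply (filterlim_comp _ _ _ cos (fun u => - boxcox q u) _ _ _ lim_cos_0).
apply (continuous_opp (V := R_NormedModule) (boxcox q)), continuous_boxcox. lra.
Qed.

Lemma lim_defect_sinc_half_pi (q : R) :
  filterlim (defect_sinc q) (at_left (PI / 2)) (locally (- boxcox (3 * q - 8/5) (2 / PI))).
Proof.
pose proof PI_RGT_0 as hpi.
replace (2 / PI) with (sin (PI / 2) / (PI / 2)) by (rewrite sin_PI2; field; lra).
apply (filterlim_at_left_of_continuous (defect_sinc q)).
apply (continuous_opp (V := R_NormedModule) (fun x => boxcox (3 * q - 8/5) (sin x / x))).
apply (continuous_comp (fun x => sin x / x) (boxcox (3 * q - 8/5))).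
- apply (ex_derive_continuous (fun x => sin x / x)). auto_derive. lra.
- apply continuous_boxcox. rewrite sin_PI2. apply Rdiv_lt_0_compat; lra.
Qed.

(** Positivity of q makes (cos x)^q tend to 0 and keeps the limit finite. Dividing the limit of
    [defect_sinc] by this one gives L. *)
Lemma lim_defect_cos_half_pi (q : R) : 0 < q ->
  filterlim (defect_cos q) (at_left (PI / 2)) (locally (1 / q)).
Proof.
intros hq. unfold defect_cos, boxcox. destruct (Req_EM_T q 0) as [|_]; [lra|].
pose proof (filterlim_comp _ _ _ cos (fun t => Rpower t q) _ _ _ lim_cos_half_pi (lim_Rpower_0 q hq)) as h.
assert (FF : Filter (at_left (PI / 2))) by (apply within_filter, locally_filter).
pose proof (filterlim_sub_scal _ _ FF (fun _ => 1 / q) _ (1 / q) _ _ (filterlim_const _) h) as k.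
replace (1 / q) with (1 / q - 1 / q * 0) by ring.
revert k. apply filterlim_ext. intros y. field. lra.
Qed.

(** * Applying the monotone rule in the two ranges of q *)

Lemma exp_lt_incr (f df : R -> R) (b : R) :
  (forall x, 0 < x < b -> is_derive f x (df x)) -> (forall x, 0 < x < b -> 0 < df x) ->
  forall x y, 0 < x -> x < y -> y < b -> exp (f x) < exp (f y).
Proof.
intros hf hdf x y h0 hxy hyb. apply exp_increasing.
apply (incr_of_derive_pos f df); [exact hxy| |]; intros c hc; [apply hf|apply hdf]; lra.
Qed.

Lemma lim_defect_combination_half_pi (q : R) : 0 < q ->
  filterlim (fun x => defect_sinc q x - - (q * boxcox (3 * q - 8/5) (2 / PI)) * defect_cos q x)
    (at_left (PI / 2)) (locally 0).
Proof.
intros hq.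
replace 0 with (- boxcox (3 * q - 8/5) (2 / PI)
  - - (q * boxcox (3 * q - 8/5) (2 / PI)) * (1 / q)) by (field; lra).
apply filterlim_sub_scal.
- apply within_filter, locally_filter.
- apply lim_defect_sinc_half_pi.
- apply lim_defect_cos_half_pi, hq.
Qed.

Lemma lim_exp_log_ratio_0 (q : R) :
  filterlim (fun x => exp (log_ratio q x)) (at_right 0) (locally (1/3)).
Proof.
rewrite <- (exp_ln (1/3)) by lra.
apply (filterlim_comp _ _ _ (log_ratio q) exp _ _ _ (lim_log_ratio_0 q)), continuous_exp.
Qed.

Lemma defect_cos'_pos (q x : R) : 0 < x < PI / 2 -> 0 < Rpower (cos x) (q - 1) * sin x.
Proof. intros hx. apply Rmult_lt_0_compat; [apply exp_pos|apply (sin_cos_pos x hx)]. Qed.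

Lemma defect_bounds_ge_1 (q x : R) : 1 <= q -> 0 < x < PI / 2 ->
  1/3 * defect_cos q x < defect_sinc q x /\
  defect_sinc q x < - (q * boxcox (3 * q - 8/5) (2 / PI)) * defect_cos q x.
Proof.
intros hq hx.
pose proof (exp_lt_incr (log_ratio q) _ _ (is_derive_log_ratio q)
  (fun x => log_ratio'_pos q x hq)) as mono.
split.
- apply (ratio_gt_initial_limit _ _ _ _ 0 (PI / 2) (is_derive_defect_sinc q)
    (is_derive_defect_cos q) (defect_cos'_pos q) mono (lim_defect_sinc_0 q)
    (lim_defect_cos_0 q) _ _ (lim_exp_log_ratio_0 q) hx).
- apply (ratio_lt_final_limit _ _ _ _ 0 (PI / 2) (is_derive_defect_sinc q)
    (is_derive_defect_cos q) (defect_cos'_pos q) mono (lim_defect_sinc_0 q)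
    (lim_defect_cos_0 q)); [|exact hx].
  apply lim_defect_combination_half_pi. lra.
Qed.

(** Here the derivative quotient decreases, so the rule is applied to [- defect_sinc] with the
    negated quotient and negated constants. *)
Lemma defect_bounds_le_34_35 (q x : R) : q <= 34/35 -> 0 < x < PI / 2 ->
  defect_sinc q x < 1/3 * defect_cos q x /\
  (0 < q -> - (q * boxcox (3 * q - 8/5) (2 / PI)) * defect_cos q x < defect_sinc q x).
Proof.
intros hq hx.
assert (mono : forall x y, 0 < x -> x < y -> y < PI / 2 ->
  - exp (log_ratio q x) < - exp (log_ratio q y)).
{ intros u v hu huv hv. apply Ropp_lt_contravar, exp_increasing, Ropp_lt_cancel.
  apply (incr_of_derive_pos (fun x => - log_ratio q x) (fun x => - log_ratio' q x)); [exact huv| |].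
  - intros c hc. apply (is_derive_opp (log_ratio q)), is_derive_log_ratio. lra.
  - intros c hc. apply Ropp_0_gt_lt_contravar, log_ratio'_neg; lra. }
assert (der : forall x, 0 < x < PI / 2 -> is_derive (fun x => - defect_sinc q x) x
  (- exp (log_ratio q x) * (Rpower (cos x) (q - 1) * sin x))).
{ intros u hu. rewrite <- Ropp_mult_distr_l.
  apply (is_derive_opp (defect_sinc q)), is_derive_defect_sinc, hu. }
assert (lim_opp : forall f (Fi : (R -> Prop) -> Prop) l, filterlim f Fi (locally l) ->
  filterlim (fun x : R => - f x) Fi (locally (- l))).
{ intros f Fi l h. apply (filterlim_comp _ _ _ f Ropp _ _ _ h).
  apply (filterlim_opp (K := R_AbsRing) (V := R_NormedModule)). }
assert (lim0 : filterlim (fun x => - defect_sinc q x) (at_right 0) (locally 0)).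
{ rewrite <- Ropp_0 at 2. apply lim_opp, lim_defect_sinc_0. }
split.
- apply Ropp_lt_cancel. rewrite Ropp_mult_distr_l.
  apply (ratio_gt_initial_limit _ _ _ _ 0 (PI / 2) der (is_derive_defect_cos q)
    (defect_cos'_pos q) mono lim0 (lim_defect_cos_0 q) _ _ (lim_opp _ _ _ (lim_exp_log_ratio_0 q)) hx).
- intros hq0. apply Ropp_lt_cancel. rewrite Ropp_mult_distr_l.
  apply (ratio_lt_final_limit _ _ _ _ 0 (PI / 2) der (is_derive_defect_cos q)
    (defect_cos'_pos q) mono lim0 (lim_defect_cos_0 q)); [|exact hx].
  rewrite <- Ropp_0. generalize (lim_opp _ _ _ (lim_defect_combination_half_pi q hq0)).
  apply filterlim_ext. intros y. ring.
Qed.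

Theorem theorem7 (x : R) (hx0 : 0 < x) (hx1 : x < PI/2) :
  (forall q : R, 1 <= q ->
     Nmean (cos x) q < sin x / x /\ sin x / x < Mmean (cos x) q) /\
  (forall q : R, 0 < q -> q <= 34/35 ->
     Mmean (cos x) q < sin x / x /\ sin x / x < Nmean (cos x) q) /\
  (forall q : R, q <= 0 -> sin x / x > Mmean (cos x) q).
Proof.
assert (hx : 0 < x < PI / 2) by lra. destruct (sin_cos_pos x hx) as [s c].
assert (hS : 0 < sin x / x) by (apply Rdiv_lt_0_compat; lra).
assert (ht : 0 < cos x < 1).
{ split; [exact c|]. rewrite <- cos_0. apply cos_decreasing_1; lra. }
(* All three quantities are compared through the increasing map B_p, p = 3q - 8/5. The minus signs
   turn a lower bound on [defect_sinc] into an upper bound on sin x / x. *)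
assert (toM : forall q, boxcox (3 * q - 8/5) (Mmean (cos x) q) = - (1/3 * defect_cos q x)).
{ intros q. rewrite boxcox_Mmean by exact ht. unfold defect_cos. ring. }
assert (toN : forall q, 0 < q -> boxcox (3 * q - 8/5) (Nmean (cos x) q) =
  - (- (q * boxcox (3 * q - 8/5) (2 / PI)) * defect_cos q x)).
{ intros q hq. rewrite boxcox_Nmean by assumption. unfold defect_cos. ring. }
assert (toS : forall q, boxcox (3 * q - 8/5) (sin x / x) = - defect_sinc q x).
{ intros q. unfold defect_sinc. ring. }
(* With no lower bound on q, this covers the lower estimate of (ii) and all of (iii). *)
assert (below : forall q, q <= 34/35 -> Mmean (cos x) q < sin x / x).
{ intros q hq. apply (boxcox_lt_inv (3 * q - 8/5)); [apply Mmean_pos|exact hS|].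
  rewrite toM, toS. apply Ropp_lt_contravar, defect_bounds_le_34_35; assumption. }
split; [|split].
- intros q hq. destruct (defect_bounds_ge_1 q x hq hx) as [hM hN]. split.
  + apply (boxcox_lt_inv (3 * q - 8/5)); [apply Nmean_pos|exact hS|].
    rewrite toN, toS by lra. apply Ropp_lt_contravar, hN.
  + apply (boxcox_lt_inv (3 * q - 8/5)); [exact hS|apply Mmean_pos|].
    rewrite toM, toS. apply Ropp_lt_contravar, hM.
- intros q hq0 hq. split; [apply below, hq|].
  apply (boxcox_lt_inv (3 * q - 8/5)); [exact hS|apply Nmean_pos|].
  rewrite toN, toS by lra. apply Ropp_lt_contravar, defect_bounds_le_34_35; assumption.
- intros q hq. apply below. lra.
Qed.
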